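(* Let $m$ be a positive integer. If $m$ is even, then $\mathfrak{pr}(P_m+P_2)=m+3$.
   Context: $P_n$ is the path on $n$ vertices. The join $G+H$ of two disjoint graphs $G$ and $H$ has vertex set $V(G)\cup V(H)$ and edge set $E(G)\cup E(H)\cup\{uv : u\in V(G), v\in V(H)\}$. All graphs are finite and simple. A coprime labeling of a graph $G$ of order $N$ is an assignment of distinct labels from $\{1,\ldots,M\}$, for some integer $M\ge N$, to the vertices of $G$ such that adjacent vertices receive relatively prime labels. The minimum coprime number $\mathfrak{pr}(G)$ is the minimum value $M$ for which such a labeling exists. *)

(* Defs.v *)
From mathcomp Require Import all_boot.
Set Implicit Arguments.
Unset Strict Implicit.
Unset Printing Implicit Defensive.

Record sgraph := SGraph {
  vertex :> finType;
  adj : rel vertex;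
  adj_sym : symmetric adj;
  adj_irr : irreflexive adj
}.

Definition path_adj n : rel 'I_n :=
  fun i j => (i.+1 == j :> nat) || (j.+1 == i :> nat).

Lemma path_adj_sym n : symmetric (@path_adj n).
Proof. by move=> i j; rewrite /path_adj orbC. Qed.

Lemma path_adj_irr n : irreflexive (@path_adj n).
Proof. by move=> i; rewrite /path_adj orbb; apply/negbTE; rewrite gtn_eqF. Qed.

Definition path_graph n : sgraph := SGraph (@path_adj_sym n) (@path_adj_irr n).

Definition join_adj (G H : sgraph) : rel (G + H)%type :=
  fun x y =>
    match x, y with
    | inl u, inl v => adj u v
    | inr u, inr v => adj u v
    | _, _ => true
    end.

Lemma join_adj_sym G H : symmetric (@join_adj G H).
Proof. by case=> u [] v //=; apply: adj_sym. Qed.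

Lemma join_adj_irr G H : irreflexive (@join_adj G H).
Proof. by case=> u /=; apply: adj_irr. Qed.

Definition graph_join (G H : sgraph) : sgraph :=
  SGraph (@join_adj_sym G H) (@join_adj_irr G H).

(* The value 0 of 'I_M.+1 is excluded, so the labels lie in {1, ..., M}. *)
Definition is_coprime_labeling (G : sgraph) (M : nat)
    (f : {ffun G -> 'I_M.+1}) : bool :=
  [&& #|G| <= M,
      injectiveb f,
      [forall v, 0 < f v] &
      [forall u, forall v, adj u v ==> coprime (f u) (f v)]].

Definition has_coprime_labeling (G : sgraph) (M : nat) : bool :=
  [exists f : {ffun G -> 'I_M.+1}, is_coprime_labeling f].

Fixpoint prime_seq n : nat :=
  if n is n'.+1 then s2val (prime_above (prime_seq n')) else 2.

Lemma prime_seq_prime n : prime (prime_seq n).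
Proof. by case: n => //= n; case: prime_above. Qed.

Lemma prime_seq_mono : {mono prime_seq : m n / m <= n}.
Proof.
apply: leq_mono; apply: homo_ltn => [? ? ?|n /=]; first exact: ltn_trans.
by case: prime_above.
Qed.

(* Labeling the vertices by distinct primes always works. *)
Lemma coprime_labeling_exists (G : sgraph) :
  exists M, has_coprime_labeling G M.
Proof.
pose p (v : G) := prime_seq (enum_rank v).
pose M := maxn #|G| (\max_v p v).
have p_inj : injective p.
  by move=> u v /(incn_inj prime_seq_mono) /val_inj /enum_rank_inj.
have pE v : (inord (p v) : 'I_M.+1) = p v :> nat.
  by rewrite inordK // ltnS leq_max leq_bigmax orbT.
exists M; apply/existsP; exists [ffun v => inord (p v)].
rewrite /is_coprime_labeling leq_maxl /=; apply/and3P; split.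
- apply/injectiveP => u v; rewrite !ffunE => /(congr1 val) /=.
  by rewrite !pE => /p_inj.
- by apply/forallP => v; rewrite ffunE pE prime_gt0 ?prime_seq_prime.
apply/forallP => u; apply/forallP => v; apply/implyP => uv.
rewrite !ffunE !pE prime_coprime ?prime_seq_prime //.
rewrite dvdn_prime2 ?prime_seq_prime // (inj_eq p_inj).
by apply: contraTneq uv => ->; rewrite adj_irr.
Qed.

Definition min_coprime_number (G : sgraph) : nat :=
  ex_minn (coprime_labeling_exists G).

(* Main.v *)
Require Import Defs.
From mathcomp Require Import all_boot.
From mathcomp Require Import zify.

Set Implicit Arguments.
Unset Strict Implicit.
Unset Printing Implicit Defensive.

(** Write m = 2k, so that the join has 2k + 2 vertices.

    Lower bound.  Adjacent vertices cannot both carry an even label, and there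
    are many edges: if both vertices of P_2 are odd, the k disjoint edges of
    the path supply k further odd labels; otherwise the even vertex of P_2
    forces all the other 2k + 1 labels to be odd.  Either way at least k + 2
    labels are odd, while {1, ..., 2k + 2} contains only k + 1 odd numbers
    (coprime_labeling_bound).

    Upper bound.  Bertrand's postulate gives a prime p with
    k + 1 < p <= 2k + 2.  No other label up to 2k + 3 < 2p is a multiple of p,
    so 1 and p can be put on P_2.  The path then lists 2, 3, ..., 2k + 3 with p
    and one even neighbour of p left out.  Consecutive integers are coprime, so
    only the step across the gap matters: it goes from p - 1 to p + 2 if p + 1
    is dropped, and from p - 2 to p + 1 if p - 1 is dropped.  In both cases the
    difference is 3, and at least one of p - 1, p - 2 is prime to 3
    (coprime_gap_at_prime, coprime_labeling_join_path).

    Bertrand's postulate is proved by Erdos's argument.  If there were no prime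
    in the interval from n (excluded) to 2n (included), the prime factorization
    of the central binomial coefficient C of 2n over n would consist of primes
    p <= sqrt (2n), each contributing a power at most 2n, and of larger
    primes p <= 2n/3, each contributing at most p, so at most 4 ^ (2n/3) in
    total (primorial_le); those between 2n/3 and n cancel.
    This is incompatible with 4 ^ n <= 2n * C once n is large
    (central_binomial_le_no_prime, bertrand_large); the remaining n are
    covered by an explicit chain of primes. *)

(** * Bertrand's postulate *)

Lemma bin_double_sym n : 'C(n.*2.+1, n.+1) = 'C(n.*2.+1, n).
Proof. by rewrite -bin_sub; [congr binomial; lia|lia]. Qed.

Lemma central_binomialS n :
  n.+1 * 'C(n.+1.*2, n.+1) = 2 * (n.*2.+1) * 'C(n.*2, n).
Proof.
have := mul_bin_diag n.*2.+2 n; have := mul_bin_down n.*2.+1 n.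
rewrite doubleS /= (_ : n.*2.+1 - n = n.+1); last by lia.
nia.
Qed.

Lemma expn4_le_central_binomial n : 0 < n -> 4 ^ n <= n.*2 * 'C(n.*2, n).
Proof.
elim: n => [//|[_ _|n IHn _]]; first by rewrite expn1.
rewrite -{1}mul2n -mulnA central_binomialS expnS.
by rewrite (leq_trans (leq_mul (leqnn 4) (IHn isT))) // !mulnA leq_mul2r; lia.
Qed.

Lemma middle_binomial_le k : 'C(k.*2.+1, k) <= 4 ^ k.
Proof.
have sumE : \sum_(i < k.*2.+2) 'C(k.*2.+1, i) = 2 * 4 ^ k.
  have := expnDn 1 1 k.*2.+1; rewrite expnS -mul2n expnM => ->.
  by apply: eq_bigr => i _; rewrite !exp1n !muln1.
have : 'C(k.*2.+1, k) + 'C(k.*2.+1, k.+1) <= 2 * 4 ^ k.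
  have hk : k < k.*2.+2 by lia.
  have hk1 : k.+1 < k.*2.+2 by lia.
  rewrite -sumE (bigD1 (Ordinal hk)) //= (bigD1 (Ordinal hk1)) /=; last first.
    by rewrite -val_eqE /=; lia.
  by rewrite addnA leq_addr.
rewrite bin_double_sym; lia.
Qed.

(** Distinct primes are coprime, so divisibility by each of them is enough. *)
Lemma prod_primes_dvdn (a b N : nat) :
    (forall p, prime p -> a <= p < b -> p %| N) ->
  \prod_(a <= p < b | prime p) p %| N.
Proof.
elim: b => [|b IHb] dvdN; first by rewrite big_geq ?dvd1n.
have [lt_ba|le_ab] := ltnP b a; first by rewrite big_geq ?dvd1n.
have {}IHb : \prod_(a <= p < b | prime p) p %| N.
  by apply: IHb => p p_pr pab; apply: dvdN => //; lia.
rewrite big_mkcond big_nat_recr //= -big_mkcond /=.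
case: ifP => [b_pr|_]; last by rewrite muln1.
rewrite Gauss_dvd ?IHb ?dvdN ?le_ab ?leqnn // coprime_sym.
rewrite big_nat_cond; elim/big_rec: _ => [|p x /andP[/andP[_ ltpb] p_pr] IHx].
  exact: coprimen1.
rewrite coprimeMr IHx andbT prime_coprime // dvdn_prime2 //; lia.
Qed.

Lemma prime_dvdn_fact p n : prime p -> p %| n`! -> p <= n.
Proof.
move=> p_pr; elim: n => [|n IHn].
  by rewrite dvdn1; case: eqP p_pr => // ->.
by rewrite factS Euclid_dvdM // => /orP[/dvdn_leq->//|/IHn/leqW].
Qed.

(** For n = 2k + 1, the primes from k + 2 to n divide the binomial coefficient
    of n over k, which is at most 4 ^ k; the smaller primes are handled by
    induction at k + 1.  An even n > 2 adds no prime. *)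
Lemma primorial_le n : \prod_(0 <= p < n.+1 | prime p) p <= 4 ^ n.
Proof.
elim/ltn_ind: n => n IHn.
have [n_le2|n_gt2] := leqP n 2.
  by case: n n_le2 {IHn} => [|[|[|]]] // _; rewrite unlock.
have [/negbTE n_odd|n_even] := boolP (~~ odd n); last first.
  move: n_even; rewrite negbK => n_odd.
  pose k := n./2; have nE : n = k.*2.+1 by rewrite /k; lia.
  rewrite nE (big_cat_nat (n := k.+2)) //=; last by lia.
  rewrite -addnn -addSn expnD leq_mul ?IHn //; first by lia.
  apply: leq_trans (middle_binomial_le k); apply: dvdn_leq.
    by rewrite bin_gt0; lia.
  rewrite addSn addnn; apply: prod_primes_dvdn => p p_pr pk.
  have pdvd : p %| 'C(k.*2.+1, k) * (k`! * (k.*2.+1 - k)`!).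
    by rewrite bin_fact; [rewrite dvdn_fact|]; lia.
  move: pdvd; rewrite !Euclid_dvdM // => /or3P[//||] /(prime_dvdn_fact p_pr);
    lia.
rewrite big_mkcond big_nat_recr //= -big_mkcond /=.
case: ifP => [/even_prime|_]; first by lia.
rewrite muln1; case: n n_gt2 IHn {n_odd} => // n n_gt2 IHn.
by rewrite (leq_trans (IHn n _)) // leq_exp2l.
Qed.

(** Legendre's formula applied to the three factorials; doubling n modulo
    p ^ k produces at most one carry, and the sum counts these carries. *)
Lemma logn_central_binomial p n : prime p ->
  logn p 'C(n.*2, n) = \sum_(1 <= k < n.*2.+1) (p ^ k <= (n %% p ^ k).*2).
Proof.
move=> p_pr.
have /(congr1 (logn p)) := bin_fact (n := n.*2) (m := n) ltac:(lia).
have -> : n.*2 - n = n by lia.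
rewrite !lognM ?muln_gt0 ?fact_gt0 ?bin_gt0 ?logn_fact //; last by lia.
have -> : \sum_(1 <= k < n.+1) n %/ p ^ k = \sum_(1 <= k < n.*2.+1) n %/ p ^ k.
  rewrite [RHS](big_cat_nat (n := n.+1)) //=; last by lia.
  rewrite [X in _ + X]big_nat [X in _ + X]big1 ?addn0 // => k /andP[nk _].
  rewrite divn_small // (leq_ltn_trans _ (ltn_expl k (prime_gt1 p_pr))) //.
  exact: ltnW.
set S := \sum_(1 <= k < _) n %/ _ => sumE.
apply/eqP; rewrite -(eqn_add2r (S + S)) sumE -!big_split /=.
apply/eqP/eq_bigr => k _.
by rewrite -(addnn n) divnD ?expn_gt0 ?prime_gt0 // addnC !addnn.
Qed.

(** A carry modulo p ^ k needs p ^ k <= 2n, so there are at most as many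
    carries as powers of p up to 2n. *)
Lemma pfactor_central_binomial_le p n : 0 < n -> prime p ->
  p ^ logn p 'C(n.*2, n) <= n.*2.
Proof.
move=> n_gt0 p_pr; have p_gt1 := prime_gt1 p_pr.
have n2_gt0 : 0 < n.*2 by lia.
rewrite (leq_trans _ (trunc_logP p_gt1 n2_gt0)) // leq_exp2l //.
rewrite logn_central_binomial //; set t := trunc_log _ _.
have le_t : t <= n.*2.
  exact: leq_trans (ltnW (ltn_expl _ p_gt1)) (trunc_logP p_gt1 n2_gt0).
rewrite (big_cat_nat (n := t.+1)) //= [X in _ + X]big_nat [X in _ + X]big1.
  rewrite addn0 -[X in _ <= X]muln1 -[X in _ <= X * 1](subn1 t.+1).
  rewrite -sum_nat_const_nat leq_sum // => k _; exact: leq_b1.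
move=> k /andP[tk _]; apply/eqP; rewrite eqb0 -ltnNge.
have : n.*2 < p ^ k.
  by rewrite (leq_trans (trunc_log_ltn n.*2 p_gt1)) // leq_exp2l.
have := leq_mod n (p ^ k); lia.
Qed.

Lemma logn_central_binomial_le1 p n : prime p -> n.*2 < p ^ 2 ->
  logn p 'C(n.*2, n) <= 1.
Proof.
move=> p_pr n_lt; have [->|n_gt0] := posnP n; first by rewrite bin0 logn1.
rewrite -ltnS -(ltn_exp2l _ _ (prime_gt1 p_pr)).
exact: leq_ltn_trans (pfactor_central_binomial_le n_gt0 p_pr) n_lt.
Qed.

(** The multiples of p up to 2n are p and 2p, with p occurring twice in (2n)!
    because p > 2, and the only one up to n is p, so that p also occurs twice
    in (n!)^2. *)
Lemma logn_central_binomial_eq0 p n : prime p -> 2 < p -> p <= n ->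
  n.*2 < 3 * p -> logn p 'C(n.*2, n) = 0.
Proof.
move=> p_pr p_gt2 le_pn lt_n3p.
rewrite logn_central_binomial // big_nat big1 // => -[//|[|k]] _;
  apply/eqP; rewrite eqb0 -ltnNge.
  rewrite expn1; have -> : n = 1 * p + (n - p) by lia.
  by rewrite modnMDl modn_small; lia.
have : n.*2 < p ^ k.+2.
  rewrite !expnS mulnA (leq_trans lt_n3p) // (@leq_trans (p * p)) //.
    by rewrite leq_mul2r p_gt2 orbT.
  by rewrite leq_pmulr // expn_gt0 prime_gt0.
have := leq_mod n (p ^ k.+2); lia.
Qed.

(** Stated with any s such that 2n < (s + 1)^2 instead of the integer square
    root of 2n: a power of 2 is more convenient for s + 1 later on. *)
Lemma central_binomial_le_no_prime n s :
    2 < n -> s <= n -> n.*2 < s.+1 ^ 2 ->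
    (forall p, prime p -> ~~ (n < p <= n.*2)) ->
  'C(n.*2, n) <= n.*2 ^ s * 4 ^ (n.*2 %/ 3).
Proof.
move=> n_gt2 le_s lt_s no_prime; set N := n.*2; set C := 'C(N, n).
have C_gt0 : 0 < C by rewrite bin_gt0 /N; lia.
have logC0 p : n < p -> logn p C = 0.
  move=> lt_np; have [p_pr|p_npr] := boolP (prime p); last first.
    by rewrite lognE (negbTE p_npr).
  rewrite logn_central_binomial // big_nat big1 // => k /andP[k_gt0 _].
  apply/eqP; rewrite eqb0 -ltnNge.
  have := no_prime p p_pr; have := leq_mod n (p ^ k).
  have := leq_pexp2l (prime_gt0 p_pr) k_gt0; rewrite expn1; lia.
pose q := N %/ 3.
have -> : C = \prod_(0 <= p < n.+1) p ^ logn p C.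
  rewrite -[LHS]partnT // (widen_partn _ (leq_maxl C n)).
  rewrite (big_cat_nat (n := n.+1)) ?ltnS ?leq_maxr //=.
  rewrite [X in _ * X]big_nat [X in _ * X]big1 ?muln1 // => p /andP[lt_np _].
  by rewrite logC0.
(* Each prime factor contributes at most small p * medium p. *)
pose small p := if 0 < p <= s then N else 1.
pose medium p := if prime p && (p <= q) then p else 1.
have small_prod : \prod_(0 <= p < n.+1) small p = N ^ s.
  rewrite (big_cat_nat (n := s.+1)) //= big_ltn // mul1n.
  rewrite [X in _ * X]big_nat [X in _ * X]big1 ?muln1; last first.
    by move=> p; rewrite /small; case: ifP => //; lia.
  rewrite (eq_big_nat _ _ (F2 := fun=> N)); last first.
    by move=> p; rewrite /small ltnS => ->.
  by rewrite prod_nat_const_nat subn1.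
have medium_prod : \prod_(0 <= p < n.+1) medium p <= 4 ^ q.
  rewrite (big_cat_nat (n := q.+1)) //=; last by rewrite /q /N; lia.
  rewrite [X in _ * X]big_nat [X in _ * X]big1 ?muln1; last first.
    by move=> p; rewrite /medium; case: ifP => //; lia.
  apply: leq_trans (primorial_le q); rewrite [X in _ <= X]big_mkcond /=.
  rewrite (eq_big_nat _ _ (F2 := fun p => if prime p then p else 1)) //.
  by move=> p; rewrite /medium ltnS /= => ->; rewrite andbT.
rewrite -small_prod (leq_trans _ (leq_mul (leqnn _) medium_prod)) // -big_split.
apply: leq_prod => p _ /=; rewrite /small /medium.
have [p_pr|p_npr] := boolP (prime p); last first.
  by rewrite lognE (negbTE p_npr) expn0; case: ifP => // _;
    rewrite muln1 /N; lia.
have p_gt1 := prime_gt1 p_pr.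
rewrite (prime_gt0 p_pr) /=; case: (leqP p s) => [le_ps|lt_sp].
  apply: leq_trans (pfactor_central_binomial_le _ p_pr) _; first by lia.
  by rewrite leq_pmulr //; case: ifP => //; lia.
have log_le1 : logn p C <= 1.
  apply: logn_central_binomial_le1 => //; apply: leq_trans lt_s _.
  by rewrite leq_exp2r.
rewrite mul1n; case: (leqP p q) => [_|lt_qp].
  by rewrite -[X in _ <= X]expn1 leq_exp2l.
have [le_pn|lt_np] := leqP p n; last by rewrite logC0.
by rewrite logn_central_binomial_eq0 //; rewrite /q /N in lt_qp *; lia.
Qed.

(** With s + 1 = 2 ^ (j + 1), so that 2n < (s + 1)^2, the two bounds on the
    central binomial coefficient give 4 ^ n <= (2n) ^ (3 (s + 1)), whereas
    2n < 4 ^ (j + 1) makes the right-hand side less than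
    2 ^ (6 (j + 1) 2 ^ (j + 1)) <= 2 ^ (2n). *)
Lemma bertrand_large n j :
    n.*2 < 4 ^ j.+1 -> 6 * j.+1 * 2 ^ j.+1 <= n.*2 ->
  exists2 p, prime p & n < p <= n.*2.
Proof.
move=> n_lt n_ge.
have n_gt2 : 5 < n.*2.
  by apply: leq_trans n_ge; have := expn_gt0 2 j.+1; nia.
have [|no_prime] := boolP [exists p : 'I_n.*2.+1, prime p && (n < p)].
  case/existsP=> p /andP[p_pr lt_np]; exists p => //.
  by rewrite lt_np -ltnS ltn_ord.
pose s := (2 ^ j.+1).-1.
have sE : s.+1 = 2 ^ j.+1 by rewrite prednK ?expn_gt0.
have n_lt' : n.*2 < s.+1 ^ 2 by rewrite sE -expnM mulnC expnM.
have C_le : 'C(n.*2, n) <= n.*2 ^ s * 4 ^ (n.*2 %/ 3).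
  apply: central_binomial_le_no_prime => // [||p p_pr]; first by lia.
    by move: n_ge; rewrite -sE; nia.
  apply: contra no_prime => /andP[lt_np le_pn].
  by apply/existsP; exists (Ordinal (le_pn : p < n.*2.+1)); rewrite /= p_pr.
have : 4 ^ n <= n.*2 ^ s.+1 * 4 ^ (n.*2 %/ 3).
  apply: leq_trans (expn4_le_central_binomial _) _; first by lia.
  by rewrite expnS -mulnA leq_mul2l C_le orbT.
(* Cubing removes the floor in the exponent 2n/3. *)
rewrite -(leq_exp2r _ _ (isT : 0 < 3)) expnMn -!expnM leqNgt; case/negP.
have -> : 4 ^ (n * 3) = 2 ^ n.*2 * 4 ^ n.*2.
  rewrite -[4]/(2 ^ 2) -!expnM -expnD; congr (_ ^ _); lia.
apply: (@leq_ltn_trans (n.*2 ^ (s.+1 * 3) * 4 ^ n.*2)).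
  by rewrite leq_mul2l leq_exp2l // leq_divM orbT.
rewrite ltn_pmul2r ?expn_gt0 //.
apply: (@leq_trans ((4 ^ j.+1) ^ (s.+1 * 3))).
  by rewrite ltn_exp2r // muln_gt0.
rewrite -expnM -[4]/(2 ^ 2) -expnM leq_exp2l // (leq_trans _ n_ge) // sE.
by apply: eq_leq; lia.
Qed.

Lemma bertrand n : 0 < n -> exists2 p, prime p & n < p <= n.*2.
Proof.
move=> n_gt0; have [n_big|n_small] := leqP 4001 n.
  pose j := (trunc_log 4 n.*2).
  have lt_j : n.*2 < 4 ^ j.+1 by apply: trunc_log_ltn.
  have le_j : 4 ^ j <= n.*2 by apply: trunc_logP; lia.
  apply: (bertrand_large lt_j).
  (* For j <= 6 the bound 5376 <= 8002 <= 2n is enough; for j >= 7 one has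
     12 (j + 1) <= 2 ^ j. *)
  have [j_lt7|j_ge7] := ltnP j 7.
    apply: (@leq_trans (6 * 7 * 2 ^ 7)); last by lia.
    by rewrite leq_mul // ?leq_mul ?leq_exp2l //.
  apply: leq_trans le_j; rewrite (expnMn 2 2 j) expnS mulnA leq_mul2r.
  have -> : 6 * j.+1 * 2 <= 2 ^ j; last by rewrite orbT.
  elim: j j_ge7 {lt_j}; first by [].
  move=> j IHj; rewrite leq_eqVlt => /predU1P[<- //|/IHj].
  rewrite expnS; lia.
(* Each prime of the list is less than twice the preceding one. *)
pose ps := [:: 2; 3; 5; 7; 13; 23; 43; 83; 163; 317; 631; 1259; 2503; 4001].
have ps_prime : all prime ps by vm_compute.
have /hasP[p p_ps pn] : has (fun p => n < p <= n.*2) ps by rewrite /=; lia.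
by exists p; first exact: (allP ps_prime).
Qed.

(** * Lower bound: counting odd labels *)

Lemma card_odd_ord n : #|[set x : 'I_n | odd x]| = n./2.
Proof.
rewrite cardsE -sum1_card big_mkcond /=.
rewrite -(big_mkord xpredT (fun i => if odd i then 1 else 0)).
elim: n => [|n IHn]; first by rewrite big_geq.
by rewrite big_nat_recr //= IHn; case: ifP; lia.
Qed.

(** The indices split into the k disjoint pairs 2i, 2i + 1. *)
Lemma leq_sum_no_adjacent_false (h : nat -> bool) k :
    (forall i, i.+1 < k.*2 -> h i || h i.+1) ->
  k <= \sum_(i < k.*2) h i.
Proof.
elim: k => [//|k IHk] hh; rewrite doubleS !big_ord_recr /=.
have /IHk : forall i, i.+1 < k.*2 -> h i || h i.+1.
  by move=> i ik; apply: hh; lia.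
have /hh : k.*2.+1 < k.+1.*2 by lia.
by case: (h _); case: (h _) => //= _; lia.
Qed.

Lemma min_coprime_number_ge G M :
  (forall N, has_coprime_labeling G N -> M <= N) -> M <= min_coprime_number G.
Proof. by move=> h; rewrite /min_coprime_number; case: ex_minnP => N /h. Qed.

Lemma min_coprime_number_le G M :
  has_coprime_labeling G M -> min_coprime_number G <= M.
Proof.
by move=> h; rewrite /min_coprime_number; case: ex_minnP => N _; apply.
Qed.

Lemma card_join_path m : #|graph_join (path_graph m) (path_graph 2)| = m + 2.
Proof. by rewrite card_sum !card_ord. Qed.

Lemma coprime_odd x y : coprime x y -> odd x || odd y.
Proof.
apply: contraLR; rewrite negb_or -!dvdn2 => /andP[x2 y2].
have : 2 %| gcdn x y by rewrite dvdn_gcd x2.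
by rewrite /coprime; case: eqP => // ->.
Qed.

Lemma coprime_labeling_odd_count (G : sgraph) M (f : {ffun G -> 'I_M.+1}) :
  is_coprime_labeling f -> \sum_v odd (f v) <= M.+1./2.
Proof.
case/and4P=> _ /injectiveP f_inj _ _; rewrite -card_odd_ord.
have -> : \sum_v odd (f v) = #|[set v | odd (f v)]|.
  rewrite -sum1_card [RHS]big_mkcond; apply: eq_bigr => v _.
  by rewrite inE; case: odd.
rewrite -(card_imset _ f_inj); apply/subset_leq_card/subsetP.
by move=> _ /imsetP[v + ->]; rewrite !inE.
Qed.

Lemma coprime_labeling_bound k M : 0 < k ->
  has_coprime_labeling (graph_join (path_graph k.*2) (path_graph 2)) M ->
  k.*2 + 3 <= M.
Proof.
move=> k_gt0 /existsP[f f_lab]; have := coprime_labeling_odd_count f_lab.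
case/and4P: f_lab; rewrite card_join_path => le_M _ _ f_cop.
have {}f_cop u v : adj u v -> odd (f u) || odd (f v).
  move=> uv; apply: coprime_odd.
  by have /forallP/(_ v)/implyP/(_ uv) := forallP f_cop u.
rewrite big_sumType /= 2!big_ord_recl big_ord0 /=.
set a := f (inr ord0); set b := f (inr _).
have ab : odd a || odd b by apply: f_cop.
(* The parity of the labels along the path, extended to all natural numbers so
   that consecutive indices can be compared without dependent bounds. *)
pose h i := if insub i is Some j then odd (f (inl j)) else true.
have hE (j : 'I_k.*2) : h j = odd (f (inl j)) by rewrite /h valK.
under eq_bigr do rewrite -hE.
have ha (i : 'I_k.*2) : odd a || h i by rewrite hE; apply: f_cop.
have hb (i : 'I_k.*2) : odd b || h i by rewrite hE; apply: f_cop.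
suff : k.+2 <= \sum_(i < k.*2) h i + odd a + odd b.
  by rewrite uphalfE !addnA addn0; set S := \sum_(i < _) _ + _ + _; lia.
have [/andP[oa ob]|] := boolP (odd a && odd b).
  rewrite oa ob !addn1 !ltnS; apply: leq_sum_no_adjacent_false => i ik.
  have ik' : i < k.*2 by lia.
  rewrite (hE (Ordinal ik')) (hE (Ordinal ik)); apply: f_cop.
  by rewrite /= /path_adj /= eqxx.
rewrite negb_and => nab.
have h1 (i : 'I_k.*2) : h i = true.
  by case/orP: nab => /negbTE o; [have := ha i|have := hb i]; rewrite o.
rewrite (eq_bigr (fun=> 1)) ?sum1_card ?card_ord; first by lia.
by move=> i _; rewrite h1.
Qed.

(** * Upper bound: a labeling from Bertrand's postulate *)

(** The two omitted numbers will be c and c + 1, one of which is p.  The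
    difference of their outer neighbours is 3, so these are coprime unless 3
    divides c - 1; taking c = p - 1 when 3 divides p - 1 avoids this. *)
Lemma coprime_gap_at_prime p : prime p -> 2 < p ->
  exists c, [/\ 1 < c, c <= p <= c.+1 & coprime c.-1 c.+2].
Proof.
move=> p_pr p_gt2; have cop c : 0 < c -> ~~ (3 %| c.-1) -> coprime c.-1 c.+2.
  move=> c_gt0 n3; have -> : c.+2 = c.-1 + 3 by lia.
  by rewrite /coprime gcdnDl -/(coprime _ _) coprime_sym prime_coprime.
have [d3|n3] := boolP (3 %| p.-1).
  by exists p.-1; split; try lia; apply: cop; lia.
by exists p; split; try lia; apply: cop; lia.
Qed.

(** The i-th term of 2, 3, 4, ... once c and c + 1 are removed. *)
Definition skip_label c i := if i.+2 < c then i.+2 else i.+4.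

Lemma coprime_skip_label c i : 1 < c -> coprime c.-1 c.+2 ->
  coprime (skip_label c i) (skip_label c i.+1).
Proof.
move=> c_gt1 c_cop; rewrite /skip_label.
have [h1|h1] := ltnP i.+2 c; have [h2|h2] := ltnP i.+3 c.
- exact: coprimenS.
- have -> : i.+1.+4 = c.+2 by lia.
  by have -> : i.+2 = c.-1 by lia.
- lia.
- exact: coprimenS.
Qed.

Lemma coprime_labeling_join_path k : 0 < k ->
  has_coprime_labeling (graph_join (path_graph k.*2) (path_graph 2))
    (k.*2 + 3).
Proof.
move=> k_gt0; have [p p_pr p_bd] := @bertrand k.+1 isT.
have p_odd : odd p by case: (even_prime p_pr) => //; lia.
have p_gt2 : 2 < p by lia.
have [c [c_gt1 c_p c_cop]] := coprime_gap_at_prime p_pr p_gt2.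
pose g (v : graph_join (path_graph k.*2) (path_graph 2)) : nat :=
  match v with
  | inl i => skip_label c i
  | inr i => if i == ord0 then 1 else p
  end.
have g_bd v : 0 < g v < (k.*2 + 3).+1.
  case: v => [i|i] /=; last by case: ifP => _; lia.
  by rewrite /skip_label; have := ltn_ord i; case: ifP; lia.
have cop_p (i : 'I_k.*2) : coprime p (skip_label c i).
  rewrite prime_coprime //; apply/negP => /dvdnP[q].
  have := g_bd (inl i); rewrite /= /skip_label; have := ltn_ord i.
  have [i_c|i_c] := ltnP i.+2 c => _ x_bd.
    by case: q => [|[|q]]; rewrite ?mulSn; lia.
  by case: q => [|[|q]]; rewrite ?mulSn; lia.
have gE v : (inord (g v) : 'I_(k.*2 + 3).+1) = g v :> nat.
  by rewrite inordK //; case/andP: (g_bd v).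
apply/existsP; exists [ffun v => inord (g v)].
apply/and4P; split; first by rewrite card_join_path; lia.
- apply/injectiveP => u v; rewrite !ffunE => /(congr1 val) /=; rewrite !gE.
  case: u v => [i|i] [j|j] /=; rewrite /skip_label.
  + move=> eq_ij; congr inl; apply: val_inj => /=.
    by move: eq_ij; do 2 case: ifP; lia.
  + by do 2 case: ifP; lia.
  + by do 2 case: ifP; lia.
  + by case: i j => [[|[|?]] hi] [[|[|?]] hj] //= eq_ij; try lia;
      congr inr; apply: val_inj.
- by apply/forallP => v; rewrite ffunE gE; case/andP: (g_bd v).
apply/forallP => u; apply/forallP => v; apply/implyP => uv; rewrite !ffunE !gE.
case: u v uv => [i|i] [j|j] /=.
- by case/orP=> /eqP <-; [|rewrite coprime_sym]; apply: coprime_skip_label.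
- by case: ifP; rewrite ?coprimen1 // coprime_sym.
- by case: ifP; rewrite ?coprime1n.
by case: i j => [[|[|?]] ?] [[|[|?]] ?] //= _; rewrite ?coprime1n ?coprimen1.
Qed.

Theorem theorem23 (m : nat) (hm : 0 < m) (m_even : ~~ odd m) :
  min_coprime_number (graph_join (path_graph m) (path_graph 2)) = m + 3.
Proof.
have mE : m = m./2.*2 by rewrite even_halfK.
have m2_gt0 : 0 < m./2 by lia.
rewrite mE; apply/eqP; rewrite eqn_leq; apply/andP; split.
  exact/min_coprime_number_le/coprime_labeling_join_path.
by apply: min_coprime_number_ge => N; apply: coprime_labeling_bound.
Qed.
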